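(* Let $(X,d,\sigma)$ be a uniformly perfect metric space equipped with a doubling measure $\sigma$, let $p\in(0,1]$ and $\tau\in(0,+\infty]$. There exists a constant $C>0$ such that, for every $f\in M^{1,p}_\tau(X)\cap\operatorname{Lip}(X)$ and every $\nabla_Hf\in D(f)\cap L^p(X)$, there exist a sequence $(a_j)_j$ of Lipschitz $(\tau,\infty,p)$-atoms and a sequence $(\lambda_j)_j$ of real numbers with $$f=\sum_j\lambda_ja_j\ \text{ in }M^{1,p}_\tau(X)\qquad\text{and}\qquad\sum_j|\lambda_j|^p\le C\big(\tau^{-p}\|f\|_{L^p(X)}^p+\|\nabla_Hf\|_{L^p(X)}^p\big).$$
   Context: $X$ is uniformly perfect if there is $\lambda\ge2$ such that $\lambda B\setminus B\ne\varnothing$ for all balls $B$ with $\lambda B\ne X$. $\sigma$ is doubling if $\sigma(B(x,2r))\le C_\sigma\sigma(B(x,r))$ for all $x\in X$, $r>0$. $\operatorname{Lip}(X)$ is the set of Lipschitz functions on $X$. $D(f)$ is the set of non-negative functions $g$ (Hajłasz gradients of $f$) with $|f(x)-f(y)|\le d(x,y)(g(x)+g(y))$ for $\sigma$-a.e. $x,y\in X$. For $\tau\in(0,\infty)$, $\|f\|_{M^{1,p}_\tau(X)}=\frac1\tau\|f\|_{L^p(X)}+\inf_{g\in D(f)}\|g\|_{L^p(X)}$, and for $\tau=+\infty$, $\|f\|_{M^{1,p}_\infty(X)}=\inf_{g\in D(f)}\|g\|_{L^p(X)}$ (a seminorm or quasi-seminorm); $M^{1,p}_\tau(X)$ is the set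 of $f$ for which this is finite. Conventions: $\frac1{+\infty}=0$ (so $\tau^{-p}\|f\|_p^p$ is read as $0$ if $\tau=+\infty$) and $+\infty\cdot a=+\infty$ for $a>0$. For $t\in(p,+\infty]$, a $\sigma$-measurable function $a$ is a $(\tau,t,p)$-atom if there are a ball $B$ and $\nabla_Ha\in D(a)\cap L^t(X)$ with: (a) $\operatorname{supp}a\subset B$; (b) $\|\nabla_Ha\|_{L^t(X)}\le\sigma(B)^{\frac1t-\frac1p}$; (c) $\|a\|_{L^t(X)}\le\tau\,\sigma(B)^{\frac1t-\frac1p}$ (no condition if $\tau=+\infty$). *)

(* Defs.v *)
From HB Require Import structures.
From mathcomp Require Import all_boot all_order all_algebra.
From mathcomp Require Import all_classical all_reals all_analysis.

Set Implicit Arguments.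
Unset Strict Implicit.
Unset Printing Implicit Defensive.

Import Order.TTheory GRing.Theory Num.Theory.
Import numFieldNormedType.Exports.

Local Open Scope classical_set_scope.
Local Open Scope ring_scope.

(* A metric space together with a sigma-algebra; no compatibility between the
   two is built in, see [borel_regular]. Measurable types are pointed, so X is
   nonempty. *)
#[short(type="measurableMetricType")]
HB.structure Definition MeasurableMetric (d : measure_display)
  (R : numDomainType) := {T of Measurable d T & Metric R T}.

Section defs.
Context (R : realType) (d : measure_display) (X : measurableMetricType d R).
Implicit Types (sigma : {measure set X -> \bar R}) (f g a : X -> R).
Implicit Types (p : R) (t tau : \bar R).

Definition uniformly_perfect : Prop :=
  exists2 lam : R, 2 <= lam & forall (x : X) (r : R), 0 < r ->
    ball x (lam * r) != setT -> ball x (lam * r) `\` ball x r !=set0.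

(* The sigma-algebra contains the Borel sets but may be larger, e.g. the
   completion or the Caratheodory sigma-algebra of an outer measure. *)
Definition borel_regular sigma : Prop :=
  open `<=` @measurable d X /\
  forall A : set X, measurable A ->
    exists B : set X, [/\ <<s open >> B, A `<=` B & sigma B = sigma A].

(* As usual for doubling measures, balls have positive finite measure: this
   excludes the two degenerate solutions of the doubling inequality, sigma = 0
   and sigma = +oo on every ball. *)
Definition doubling_measure sigma : Prop :=
  [/\ borel_regular sigma,
      forall (x : X) (r : R), 0 < r -> (0 < sigma (ball x r) < +oo)%E
    & exists C : R, forall (x : X) (r : R), 0 < r ->
        (sigma (ball x (2 * r)) <= C%:E * sigma (ball x r))%E].

Definition lipschitz_function f : Prop :=
  exists L : R, forall x y : X, `|f x - f y| <= L * mdist x y.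

Definition Lp_norm sigma t f : \bar R := ('N[sigma]_t[EFin \o f])%E.

(* "sigma-a.e. x, y" means: for all x, y outside one common null set. *)
Definition hajlasz_gradients sigma f : set (X -> R) :=
  [set g : X -> R | [/\ measurable_fun setT g, forall x, 0 <= g x &
    exists2 N : set X, sigma.-negligible N &
      forall x y, ~ N x -> ~ N y -> `|f x - f y| <= mdist x y * (g x + g y)]].

(* For tau = +oo the first summand vanishes, as +oo^-1 = 0 and 0 * +oo = 0. *)
Definition hajlasz_norm sigma p tau f : \bar R :=
  (tau^-1 * Lp_norm sigma p%:E f +
   ereal_inf [set Lp_norm sigma p%:E g | g in hajlasz_gradients sigma f])%E.

Definition hajlasz_space sigma p tau : set (X -> R) :=
  [set f : X -> R | measurable_fun setT f /\ (hajlasz_norm sigma p tau f < +oo)%E].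

(* [fine t^-1] is 1/t, and 0 for t = +oo. For tau = +oo the last condition is
   void, its right-hand side being +oo. *)
Definition hajlasz_atom sigma tau t p a : Prop :=
  measurable_fun setT a /\
  exists (x : X) (r : R) (g : X -> R),
    [/\ 0 < r,
        hajlasz_gradients sigma a g /\ g \in Lfun sigma t,
        closure [set y | a y != 0] `<=` ball x r,
        (Lp_norm sigma t g <=
          sigma (ball x r) `^ (fine t^-1 - p^-1)%R)%E
      & (Lp_norm sigma t a <=
          tau * sigma (ball x r) `^ (fine t^-1 - p^-1)%R)%E].

End defs.

(* Main.v *)
Require Import Defs.
From HB Require Import structures.
From mathcomp Require Import all_boot all_order all_algebra.
From mathcomp Require Import all_classical all_reals all_analysis.
From mathcomp Require Import measurable_realfun ess_sup_inf ring lra zify.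

(** The atoms come from a telescoping decomposition over dyadic levels. The
    Hajlasz inequality is pointwise: [f] is [2 * 2 ^ k]-Lipschitz on the set
    [E_k] of the points outside a null set [N] where the majorant
    [w = max (g, |f| / tau)] is at most [2 ^ k]. Extend [f] from [E_k] to a
    [2 * 2 ^ k]-Lipschitz function [phi k] with [|phi k| <= tau * 2 ^ k]
    ([lipschitz_approximations]). At each point outside [N], [phi k] agrees with
    [f] once [k] is large, while the differences [phi k x - phi k y] tend to [0]
    as [k] tends to minus infinity; so [f] is almost everywhere the sum over all
    integers [k] of [u = phi (k + 1) - phi k], up to a constant if [tau = +oo].
    Each [u] is [6 * 2 ^ k]-Lipschitz and vanishes on [E_k], so that
    [sigma {u <> 0} <= sigma {w > 2 ^ k}].

    A [K]-Lipschitz function [u] splits into atoms because [|u| / K] is a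
    Whitney radius for the open set [{u <> 0}]: a maximal disjoint family of
    small balls with these radii has comparable balls wherever two of them meet,
    hence covers after enlargement ([whitney_cover]). Clamping [u] between
    growing envelopes made of tents over these balls cuts it into
    [10 * K]-Lipschitz pieces, one for each ball ([clamp_decomposition]); by
    doubling, the balls have total measure bounded by that of [{u <> 0}]
    ([lipschitz_decomposition]). A [M]-Lipschitz function supported in a set [S]
    has the gradient [M] times the indicator of [S] ([lipschitz_bump]), so each
    piece is an atom times a coefficient with p-th power
    [(60 * 2 ^ k) ^ p * sigma B] ([normalized_atom]). Summing over the balls and
    then over [k] leaves the series of [2 ^ (k * p) * sigma {w > 2 ^ k}], which
    a geometric sum compares with the integral of [w ^ p]
    ([esum_dyadic_measure_le]).

    For the convergence, let [h] be the sum of the gradients of the pieces of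
    index at least [n]. Absolute convergence makes [h] a gradient of the n-th
    remainder and an upper bound for the absolute value of this remainder
    divided by [tau] ([remainder_increment_le], [remainder_size_le]); since
    [p <= 1], the integral of [h ^ p] is at most the tail of the series of the
    p-th powers of the coefficients ([integral_bumps], [hajlasz_norm_cvg0]). *)

Set Implicit Arguments.
Unset Strict Implicit.
Unset Printing Implicit Defensive.

Import Order.TTheory GRing.Theory Num.Theory.
Import numFieldNormedType.Exports.

Local Open Scope classical_set_scope.
Local Open Scope ring_scope.

(** * Lipschitz functions *)

Definition lipschitz_on_with (R : realType) (X : metricType R) (K : R)
    (E : set X) (f : X -> R) : Prop :=
  forall x y, E x -> E y -> `|f x - f y| <= K * mdist x y.

Definition lipschitz_with (R : realType) (X : metricType R) (K : R)
    (f : X -> R) : Prop :=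
  forall x y, `|f x - f y| <= K * mdist x y.

Section lipschitz_with.
Context (R : realType) (X : metricType R).
Implicit Types (f g : X -> R) (K L c rho : R) (E : set X).

Lemma lipschitz_with_cst K c : 0 <= K -> lipschitz_with (X := X) K (cst c).
Proof. by move=> K0 x y; rewrite subrr normr0 mulr_ge0 ?mdist_ge0. Qed.

Lemma lipschitz_with_le K L f : K <= L -> lipschitz_with K f ->
  lipschitz_with L f.
Proof.
by move=> KL Kf x y; rewrite (le_trans (Kf x y))// ler_wpM2r ?mdist_ge0.
Qed.

Lemma lipschitz_withN K f : lipschitz_with K f ->
  lipschitz_with K (fun x => - f x).
Proof. by move=> Kf x y; rewrite -opprD normrN. Qed.

Lemma lipschitz_withB K L f g : lipschitz_with K f -> lipschitz_with L g ->
  lipschitz_with (K + L) (fun x => f x - g x).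
Proof.
move=> Kf Lg x y.
have -> : f x - g x - (f y - g y) = (f x - f y) - (g x - g y) by ring.
by rewrite (le_trans (ler_normB _ _))// mulrDl lerD.
Qed.

Lemma lipschitz_withZ K c f : lipschitz_with K f ->
  lipschitz_with (`|c| * K) (fun x => c * f x).
Proof. by move=> Kf x y; rewrite -mulrBr normrM -mulrA ler_wpM2l. Qed.

Lemma lipschitz_with_max K f g : lipschitz_with K f -> lipschitz_with K g ->
  lipschitz_with K (fun x => Num.max (f x) (g x)).
Proof.
move=> Kf Kg x y; move: (Kf x y) (Kg x y); rewrite !ler_norml.
move=> /andP[? ?] /andP[? ?].
by case: (leP (f x) (g x)) => ?; case: (leP (f y) (g y)) => ?; lra.
Qed.

Lemma lipschitz_with_min K f g : lipschitz_with K f -> lipschitz_with K g ->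
  lipschitz_with K (fun x => Num.min (f x) (g x)).
Proof.
move=> Kf Kg x y; move: (Kf x y) (Kg x y); rewrite !ler_norml.
move=> /andP[? ?] /andP[? ?].
by case: (leP (f x) (g x)) => ?; case: (leP (f y) (g y)) => ?; lra.
Qed.

Lemma lipschitz_with_dist (c : X) : lipschitz_with 1 (fun x => mdist c x).
Proof.
move=> x y; rewrite mul1r ler_norml.
have h1 := metric_triangle c y x; have h2 := metric_triangle c x y.
rewrite (metric_sym y x) in h1; lra.
Qed.

Lemma lipschitz_with_continuous K f : lipschitz_with K f -> continuous f.
Proof.
move=> Kf x; apply/cvgrPdist_lt => e e0.
apply/nbhs_ballP; exists (e / (`|K| + 1)) => /=.
  by rewrite divr_gt0// ltr_wpDl.
move=> y; rewrite ballEmdist /= ltr_pdivlMr ?ltr_wpDl// => xye.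
apply: le_lt_trans (Kf x y) _; apply: le_lt_trans xye.
rewrite mulrC ler_wpM2l ?mdist_ge0//.
by rewrite (le_trans (ler_norm _))// lerDl.
Qed.

(** McShane's formula: the supremum of the minorants [f y - K * d(y, .)], over
    [y] in [E]. *)
Lemma lipschitz_extension K E f : 0 <= K -> lipschitz_on_with K E f ->
  exists2 F, lipschitz_with K F & forall x, E x -> F x = f x.
Proof.
move=> K0 Kf.
have [E0|/set0P[x0 Ex0]] := eqVneq E set0.
  exists (cst 0); first exact: lipschitz_with_cst.
  by move=> x; rewrite E0.
pose S x := [set f y - K * mdist y x | y in E].
have S0 x : S x !=set0 by exists (f x0 - K * mdist x0 x), x0.
have Sub x : has_ubound (S x).
  exists (f x0 + K * mdist x0 x) => _ [y Ey <-].
  have := Kf _ _ Ey Ex0; rewrite ler_norml => /andP[_].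
  have := metric_triangle y x x0; rewrite (metric_sym x x0).
  by move=> /(ler_wpM2l K0); rewrite mulrDr; lra.
have Fle x y : sup (S x) <= sup (S y) + K * mdist x y.
  apply: ge_sup => // _ [z Ez <-].
  have : f z - K * mdist z y <= sup (S y).
    by apply: ub_le_sup => //; exists z.
  have := metric_triangle z x y => /(ler_wpM2l K0); rewrite mulrDr; lra.
exists (fun x => sup (S x)) => [x y|x Ex].
  rewrite ler_norml; have := Fle x y; have := Fle y x.
  by rewrite (metric_sym y x); lra.
apply/eqP; rewrite eq_le; apply/andP; split.
  apply: ge_sup => // _ [y Ey <-].
  by have := Kf _ _ Ey Ex; rewrite ler_norml => /andP[_]; lra.
by apply: ub_le_sup => //; exists x => //; rewrite mdistxx mulr0 subr0.
Qed.

(** Clamping an extension preserves a bound on the data; [theta = 0] stands for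
    the absence of a bound. *)
Lemma bounded_lipschitz_extension K theta M E f : 0 <= K -> 0 <= theta ->
  0 <= M -> lipschitz_on_with K E f -> (forall x, E x -> theta * `|f x| <= M) ->
  exists F, [/\ lipschitz_with K F, forall x, theta * `|F x| <= M &
    forall x, E x -> F x = f x].
Proof.
move=> K0; rewrite le_eqVlt => /predU1P[<- M0 Kf _|t0 M0 Kf fM].
  have [F KF Ff] := lipschitz_extension K0 Kf.
  by exists F; split => // x; rewrite mul0r.
have [F KF Ff] := lipschitz_extension K0 Kf.
have c0 : 0 <= M / theta by rewrite divr_ge0// ltW.
have bound z : (theta * `|z| <= M) = (- (M / theta) <= z <= M / theta).
  by rewrite mulrC -ler_pdivlMr// ler_norml.
move: (M / theta) c0 bound => c c0 bound.
exists (fun x => Num.max (- c) (Num.min (F x) c)); split.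
- apply: lipschitz_with_max; first exact: lipschitz_with_cst.
  by apply: lipschitz_with_min => //; exact: lipschitz_with_cst.
- move=> x; rewrite bound.
  by rewrite le_max lexx /= ge_max ge_min lexx orbT andbT; lra.
- move=> x Ex; rewrite Ff//; have := fM _ Ex; rewrite bound => /andP[? ?].
  by rewrite min_l// max_r.
Qed.

(** A pair with no point in [S] has increment [0]; any other pair has a point at
    which the gradient equals the Lipschitz constant. *)
Lemma lipschitz_bump (M : R) (S : set X) (b : X -> R) (x y : X) :
  0 <= M -> lipschitz_with M b -> (forall z, ~ S z -> b z = 0) ->
  `|b x - b y| <= mdist x y * (M * \1_S x + M * \1_S y).
Proof.
move=> M0 Mb b0; rewrite -mulrDr mulrCA mulrA.
have [Sx|Sx] := pselect (S x).
  rewrite indicE mem_set// (le_trans (Mb x y))//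
      ler_peMr ?mulr_ge0 ?mdist_ge0//.
  by rewrite lerDl.
have [Sy|Sy] := pselect (S y).
  rewrite [\1_S y]indicE mem_set// (le_trans (Mb x y))//.
  by rewrite ler_peMr ?mulr_ge0 ?mdist_ge0// lerDr.
by rewrite !b0// subrr normr0 !mulr_ge0 ?mdist_ge0// addr_ge0.
Qed.

End lipschitz_with.

(** * Cutting a Lipschitz function into bumps *)

Section clamping.
Context (R : realType) (X : metricType R).
Variables (K : R) (u : X -> R) (c : nat -> X) (rho : nat -> R).
Hypotheses (K0 : 0 <= K) (Ku : lipschitz_with K u).

Let K5 : 0 <= 5 * K. Proof. by rewrite mulr_ge0. Qed.

(* The slope [5 * K] lets a tent of radius [rho / 2] dominate [u], of slope [K],
   well inside its ball although it vanishes before the boundary. *)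
Let tent n x := 5 * K * (rho n / 2 - mdist (c n) x).

Let envelope := fix m n x :=
  if n is n'.+1 then Num.max (m n' x) (tent n' x) else 0.

Let clamped n x := Num.max (- envelope n x) (Num.min (u x) (envelope n x)).

Let lipschitz_tent n : lipschitz_with (5 * K) (tent n).
Proof.
move=> x y; rewrite /tent -mulrBr normrM (ger0_norm K5) ler_wpM2l//.
have := @lipschitz_with_dist _ _ (c n) x y; rewrite /= mul1r !ler_norml.
by move=> /andP[? ?]; lra.
Qed.

Let lipschitz_envelope n : lipschitz_with (5 * K) (envelope n).
Proof.
elim: n => [|n IH] /=; first exact: lipschitz_with_cst.
exact: lipschitz_with_max.
Qed.

Let envelope_ge0 n x : 0 <= envelope n x.
Proof. by elim: n => //= n IH; rewrite le_max IH. Qed.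

Let lipschitz_clamped n : lipschitz_with (5 * K) (clamped n).
Proof.
apply: lipschitz_with_max; first exact: lipschitz_withN.
apply: lipschitz_with_min => //; apply: lipschitz_with_le Ku.
by rewrite ler_peMl// ler1n.
Qed.

Let clamped_le n x : `|clamped n x| <= `|u x|.
Proof.
have := envelope_ge0 n x; rewrite /clamped; move: (envelope n x) => m m0.
rewrite ler_norml le_max ge_max ge_min le_min.
have := ler_norm (u x); have := ler_normr (- u x) (u x).
have := normr_ge0 (u x); have := lerNnormlW (lexx `|u x|).
case: (leP (- m) (- `|u x|)) => /=; case: (leP m `|u x|) => /=; lra.
Qed.

Let envelope_ge n m : (m < n)%N -> forall x,
  tent m x <= envelope n x.
Proof.
elim: n => //= n IH; rewrite ltnS leq_eqVlt => /predU1P[->|/IH mn] x.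
  by rewrite le_max lexx orbT.
by rewrite le_max mn.
Qed.

(** Clamping [u] between growing envelopes built from tents cuts it into
    pieces supported in single balls: the n-th tent changes the clamped function
    only where it is positive. Since a maximum of tents is as Lipschitz as each
    of them, the constant does not depend on how the balls overlap. *)
Lemma clamp_decomposition :
  (forall x, u x != 0 ->
    exists i, `|u x| <= 5 * K * (rho i / 2 - mdist (c i) x)) ->
  exists b : nat -> X -> R,
  [/\ forall i, lipschitz_with (10 * K) (b i),
      forall i x, rho i / 2 <= mdist (c i) x -> b i x = 0,
      forall i x, `|b i x| <= 2 * `|u x|
    & forall x, exists n0, forall n, (n0 <= n)%N -> \sum_(i < n) b i x = u x].
Proof.
move=> cover; exists (fun n x => clamped n.+1 x - clamped n x); split.
- move=> i; have -> : 10 * K = 5 * K + 5 * K by ring.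
  exact: lipschitz_withB.
- move=> i x rx; suff eE : envelope i.+1 x = envelope i x.
    by rewrite /clamped eE subrr.
  rewrite /= max_l//; apply: le_trans (envelope_ge0 i x).
  by rewrite /tent mulr_ge0_le0// subr_le0.
- move=> i x; rewrite (le_trans (ler_normB _ _))//.
  by have := clamped_le i.+1 x; have := clamped_le i x; lra.
- move=> x.
  have sumE n : \sum_(i < n) (clamped i.+1 x - clamped i x) = clamped n x.
    rewrite -(big_mkord xpredT (fun i => clamped i.+1 x - clamped i x)).
    rewrite telescope_sumr// [clamped 0 x]/clamped/= oppr0.
    by rewrite max_l ?subr0// ge_min lexx orbT.
  have [u0|/cover[i ui]] := eqVneq (u x) 0.
    exists 0%N => n _; rewrite sumE u0; apply/eqP.
    by rewrite -normr_le0 (le_trans (clamped_le n x))// u0 normr0.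
  exists i.+1 => n /envelope_ge-/(_ x) /(le_trans ui).
  rewrite sumE /clamped ler_norml => /andP[? ?].
  by rewrite min_l// max_r.
Qed.

End clamping.

(** * Whitney coverings in a doubling space *)

Section covering.
Local Open Scope ereal_scope.

(** At most [n * mu Om] of the sets have measure greater than [1 / n]. *)
Lemma trivIset_countable (d : measure_display) (T : measurableType d)
    (R : realType) (mu : {measure set T -> \bar R}) (J : pointedType)
    (E : set J) (F : J -> set T) (Om : set T) :
  measurable Om -> mu Om < +oo -> (forall i, E i -> F i `<=` Om) ->
  (forall i, E i -> measurable (F i)) -> (forall i, E i -> 0 < mu (F i)) ->
  trivIset E F -> countable E.
Proof.
move=> mOm Omoo FOm mF F0 tF.
have mu_fin i : E i -> mu (F i) \is a fin_num.
  move=> Ei; rewrite ge0_fin_numE//; apply: le_lt_trans Omoo.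
  by apply: le_measure; rewrite ?inE; [exact: mF|exact: mOm|exact: FOm].
rewrite [X in countable X](_ : _ =
    \bigcup_n [set i | E i /\ (n.+1%:R^-1)%:E < mu (F i)]); last first.
  apply/seteqP; split=> [i /= Ei|i/= [k _] []//].
  have : (0 < fine (mu (F i)))%R by rewrite fine_gt0// F0//= ltey_eq mu_fin.
  move=> /ltr_add_invr[k]; rewrite add0r => kFi.
  by exists k => //=; split=> //; rewrite -(fineK (mu_fin _ Ei)) lte_fin.
apply: bigcup_countable => // n _; apply: finite_set_countable.
apply: contrapT => /infiniteP/pcard_leP/injfunPex[/= q q_fun q_inj].
have Eq k : E (q k) by have [] := q_fun k I.
have mq : measurable (\bigcup_k F (q k)).
  by apply: bigcup_measurable => k _; exact: mF.
have : mu (\bigcup_k F (q k)) <= mu Om.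
  by apply: le_measure; rewrite ?inE//; apply: bigcup_sub => k _; exact: FOm.
have -> : mu (\bigcup_k F (q k)) = \sum_(0 <= k <oo) mu (F (q k)).
  rewrite measure_bigcup//.
  - by apply: eq_eseriesl => // i; rewrite in_setT.
  - by move=> k _; exact: mF.
  - move=> i j _ _ /tF ij; apply: q_inj; rewrite ?inE//; exact: ij.
have Omfin : mu Om \is a fin_num by rewrite ge0_fin_numE.
pose N := (Num.truncn (fine (mu Om) * n.+1%:R)).+1.
apply/negP; rewrite -ltNge.
apply: (@lt_le_trans _ _ (\sum_(0 <= k < N) (n.+1%:R^-1)%:E)); last first.
  apply: (le_trans _ (nneseries_lim_ge N _)) => //.
  by apply: lee_sum => k _; have [_ /ltW] := q_fun k I.
rewrite sumEFin sumr_const_nat subn0 -(fineK Omfin) lte_fin -[ltRHS]mulr_natl.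
by rewrite ltr_pdivlMr// truncnS_gt.
Qed.

End covering.

Section doubling.
Context (R : realType) (d : measure_display) (X : measurableMetricType d R).
Variable sigma : {measure set X -> \bar R}.
Hypothesis doubling : doubling_measure sigma.

Lemma measurable_open (A : set X) : open A -> measurable A.
Proof. by case: doubling => -[+ _] _ _; apply. Qed.

Lemma open_mball (x : X) r : open (ball x r).
Proof.
rewrite openE => y; rewrite ballEmdist/= => xy.
apply/nbhs_ballP; exists (r - mdist x y) => /=; first by rewrite subr_gt0.
move=> z; rewrite !ballEmdist/= ltrBrDl.
exact/le_lt_trans/metric_triangle.
Qed.

Lemma measurable_mball (x : X) r : measurable (ball x r).
Proof. exact/measurable_open/open_mball. Qed.

Lemma measure_mball_fin_num (x : X) r : 0 < r -> sigma (ball x r) \is a fin_num.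
Proof.
case: doubling => _ + _ r0 => /(_ x r r0)/andP[_ ?].
by rewrite ge0_fin_numE.
Qed.

Lemma measure_mball_gt0 (x : X) r : 0 < r -> (0 < sigma (ball x r))%E.
Proof. by case: doubling => _ + _ r0 => /(_ x r r0)/andP[]. Qed.

Lemma open_preimage_continuous (u : X -> R) (A : set R) :
  continuous u -> open A -> open (u @^-1` A).
Proof. by move=> cu oA; apply: open_comp => // x _; exact: cu. Qed.

Lemma measurable_lipschitz_with K (u : X -> R) : lipschitz_with K u ->
  measurable_fun setT u.
Proof.
move=> /lipschitz_with_continuous cu.
apply: (measurability _ (RGenOpens.measurableE R)) => _ [_ [x [y ->]] <-].
by rewrite setTI; exact/measurable_open/open_preimage_continuous/interval_open.
Qed.

Lemma open_support K (u : X -> R) : lipschitz_with K u ->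
  open [set x | u x != 0].
Proof.
move=> /lipschitz_with_continuous cu.
exact: (open_preimage_continuous cu (@open_neq R 0)).
Qed.

(** A [K]-Lipschitz [u] makes [|u x| / K] a Whitney radius: the ball of that
    radius around [x] stays in [{u <> 0}], and the radius itself is 1-Lipschitz,
    so that intersecting small balls have comparable sizes. A maximal disjoint
    family of small balls therefore covers after enlargement, whatever the
    supremum of the radii. A vanishing [rho i] is a void entry. *)
Lemma whitney_cover K (u : X -> R) : 0 < K -> lipschitz_with K u ->
  (sigma [set x | u x != 0%R] < +oo)%E ->
  exists (c : nat -> X) (rho : nat -> R),
  [/\ forall i, 0 <= rho i,
      trivIset setT (fun i => ball (c i) (rho i / 10)),
      forall i, ball (c i) (rho i / 10) `<=` [set x | u x != 0]
    & forall x, u x != 0 ->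
        exists i, `|u x| <= 5 * K * (rho i / 2 - mdist (c i) x)].
Proof.
move=> K0 Ku uoo; pose r x := `|u x| / K.
have rE x : `|u x| = K * r x by rewrite /r mulrC divfK// gt_eqF.
have r0 x : u x != 0 -> 0 < r x by move=> ux; rewrite divr_gt0// normr_gt0.
have rlip x y : r x <= r y + mdist x y.
  rewrite -(ler_pM2l K0) mulrDr -!rE.
  by have := Ku x y; have := lerB_dist (u x) (u y); lra.
pose F x := ball x (r x / 10).
have Fu x : F x `<=` [set y | u y != 0].
  move=> y; rewrite /F ballEmdist/= => xy; rewrite -normr_gt0 rE mulr_gt0//.
  have := rlip x y; have := mdist_ge0 x y; lra.
have [E [Eu tE maxE]] := ex_maximal_disjoint_subcollection F [set x | u x != 0].
have meetE x : u x != 0 -> exists2 y, E y & F x `&` F y !=set0.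
  move=> ux; apply: contrapT => noE.
  have Fx : F x x by rewrite /F ballEmdist/= mdistxx divr_gt0// r0.
  have Ex : ~ E x by move=> Ex; apply: noE; exists x => //; exists x.
  apply: (maxE (E `|` [set x])).
  - split; first exact: subsetUl.
    by move=> /(_ x); apply: contra_not Ex; apply; right.
  - by move=> y [/Eu//|->].
  - move=> y z [Ey|->] [Ez|->] //; first exact: tE.
      by rewrite setIC => yx; exfalso; apply: noE; exists y.
    by move=> xz; exfalso; apply: noE; exists z.
have /countable_injP[n ninj] : countable E.
  apply: (@trivIset_countable _ _ _ sigma _ E F [set x | u x != 0]) => //.
  - exact/measurable_open/(open_support Ku).
  - by move=> x _; exact: measurable_mball.
  - by move=> x /Eu ux; apply: measure_mball_gt0; rewrite divr_gt0// r0.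
pose P i := [set x | E x /\ n x = i].
pose c i := get (P i); pose rho i := if `[< P i !=set0 >] then r (c i) else 0.
have PcE i : 0 < rho i -> P i (c i) /\ rho i = r (c i).
  rewrite /rho; case: asboolP => [[x Px] _|_]; last by rewrite ltxx.
  by split => //; exact: getI Px.
have c_n x : E x -> c (n x) = x.
  move=> Ex; have [Ec nc] : P (n x) (c (n x)) by apply: (@getI _ _ x).
  by apply: ninj => //; rewrite inE.
have rho_n x : E x -> rho (n x) = r x.
  move=> Ex; rewrite /rho c_n//; case: asboolP => // -[].
  by exists x.
have ball_gt0 i x : ball (c i) (rho i / 10) x -> 0 < rho i.
  rewrite ballEmdist/= => h.
  by have := le_lt_trans (mdist_ge0 _ _) h; rewrite pmulr_lgt0 ?invr_gt0.
exists c, rho; split.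
- move=> i; rewrite /rho; case: ifP => // _.
  by rewrite divr_ge0// ltW.
- move=> i j _ _ [x [ix jx]].
  have [[Ei ni] ri] := PcE _ (ball_gt0 _ _ ix).
  have [[Ej nj] rj] := PcE _ (ball_gt0 _ _ jx).
  rewrite -ni -nj; congr n; apply: tE => //; exists x.
  by rewrite /F -ri -rj.
- move=> i x ix; have [_ ri] := PcE _ (ball_gt0 _ _ ix).
  by apply: (Fu (c i)); rewrite /F -ri.
- move=> x ux; have [y Ey [z [xz yz]]] := meetE x ux.
  exists (n y); rewrite rho_n// c_n// rE.
  move: xz yz; rewrite /F !ballEmdist/= => xz yz.
  (* Writing [d] for the distance, [d(y, x) < (r x + r y) / 10] and
     [r x <= r y + d(y, x)] give [r x <= 11 / 9 * r y] and
     [d(y, x) <= 2 / 9 * r y]. *)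
  have yx : mdist y x <= mdist y z + mdist x z.
    by rewrite [mdist x z]metric_sym; exact: metric_triangle.
  have := rlip x y; rewrite [mdist x y]metric_sym => rxy.
  rewrite [5 * K]mulrC -mulrA ler_pM2l//.
  by have := mdist_ge0 y z; lra.
Qed.

Lemma measure_mball_enlarge : exists2 A : R, 0 < A & forall (x : X) r, 0 <= r ->
  (sigma (ball x r) <= A%:E * sigma (ball x (r / 10)))%E.
Proof.
case: (doubling) => _ _ [C0 hC0]; pose C := Num.max C0 1.
have C0' : 0 < C by rewrite lt_max ltr01 orbT.
have hC (x : X) r : 0 < r ->
    (sigma (ball x (2 * r)) <= C%:E * sigma (ball x r))%E.
  move=> r0; apply: le_trans (hC0 x r r0) _.
  by rewrite lee_wpmul2r// lee_fin le_max lexx.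
(* Four doublings, as [10 <= 2 ^ 4]. *)
exists (C ^+ 4); first exact: exprn_gt0.
move=> x r; rewrite le_eqVlt => /predU1P[<-|r0].
  have -> : ball x 0 = set0.
    by rewrite -subset0 => y; rewrite ballEmdist/= ltNge mdist_ge0.
  by rewrite measure0 mule_ge0// lee_fin exprn_ge0// ltW.
have r10 : 0 < r / 10 by lra.
apply: (@le_trans _ _ (sigma (ball x (2 * (2 * (2 * (2 * (r / 10)))))))).
  apply: le_measure; rewrite ?inE; [exact: measurable_mball..|].
  by apply: le_ball; lra.
have step (s : R) (a : \bar R) : 0 < s -> (sigma (ball x s) <= a)%E ->
    (sigma (ball x (2 * s)) <= C%:E * a)%E.
  move=> s0 h; apply: le_trans (hC x s s0) _.
  by rewrite lee_wpmul2l// lee_fin ltW.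
rewrite !exprS expr0 mulr1 !EFinM -!muleA.
by do 3 (apply: (step _ _ _); first lra); exact: hC.
Qed.

(** The small disjoint balls have total measure at most that of [{u <> 0}];
    doubling carries this over to the enlarged balls, which support the
    pieces. *)
Lemma lipschitz_decomposition : exists2 A : R, 0 < A &
  forall K (u : X -> R), 0 < K -> lipschitz_with K u ->
  (sigma [set x | u x != 0%R] < +oo)%E ->
  exists (b : nat -> X -> R) (c : nat -> X) (rho : nat -> R),
  [/\ forall i, lipschitz_with (10 * K) (b i),
      forall i, 0 <= rho i /\ forall x, rho i / 2 <= mdist (c i) x -> b i x = 0,
      forall i x, `|b i x| <= 2 * `|u x|,
      forall x, exists n0, forall n, (n0 <= n)%N -> \sum_(i < n) b i x = u x
    & (\sum_(0 <= i <oo) sigma (ball (c i) (rho i)) <=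
         A%:E * sigma [set x | (u x != 0)%R])%E].
Proof.
have [A A0 hA] := measure_mball_enlarge; exists A => // K u K0 Ku uoo.
have [c [rho [rho0 trho rhou cov]]] := whitney_cover K0 Ku uoo.
have [b [b1 b2 b3 b4]] := clamp_decomposition (ltW K0) Ku cov.
exists b, c, rho; split => //; first by move=> i; split => //; exact: b2.
apply: (@le_trans _ _
  (\sum_(0 <= i <oo) A%:E * sigma (ball (c i) (rho i / 10)))%E).
  by apply: lee_nneseries => // i _; exact: hA.
rewrite nneseriesZl// lee_pmul2l//.
have mB i : measurable (ball (c i) (rho i / 10)) by exact: measurable_mball.
rewrite (_ : (\sum_(0 <= i <oo) _)%E =
    sigma (\bigcup_i ball (c i) (rho i / 10))); last first.
  by rewrite measure_bigcup//; apply: eq_eseriesl => i; rewrite in_setT.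
apply: le_measure; rewrite ?inE.
- exact: bigcup_measurable.
- exact/measurable_open/(open_support Ku).
- by apply: bigcup_sub => i _; exact: rhou.
Qed.

End doubling.

(** * Dyadic sums and subadditivity of powers *)

Section dyadic_sums.
Context (R : realType).
Implicit Types (p y : R) (s : seq int).

Let a p (k : int) : R := (2 ^ k) `^ p.

Let aS p k : a p (k - 1) = a p k * (2^-1 `^ p).
Proof. by rewrite /a expfzDr ?pnatr_eq0// powRM ?exprz_ge0// invr_ge0. Qed.

Let a_gt0 p k : 0 < a p k.
Proof. by rewrite powR_gt0// exprz_gt0. Qed.

(** The sum of the geometric series of ratio [2 ^ (- p)]. *)
Definition dyadic_cst p : R := (1 - 2^-1 `^ p)^-1.

Lemma dyadic_cst_gt0 p : 0 < p -> 0 < dyadic_cst p.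
Proof.
move=> p0; rewrite invr_gt0 subr_gt0.
suff : 2^-1 `^ p < 1 `^ p :> R by rewrite powR1.
by rewrite gt0_ltr_powR ?nnegrE ?invr_ge0// invf_lt1// ltr1n.
Qed.

Let le_a p k l : 0 < p -> k <= l -> a p k <= a p l.
Proof.
move=> p0 kl; apply: ge0_ler_powR; rewrite ?nnegrE ?exprz_ge0 ?(ltW p0)//.
by rewrite ler_eXz2l// ltr1n.
Qed.

Let sum_sorted p m s : 0 < p -> path >%O m s ->
  \sum_(k <- m :: s) a p k <= dyadic_cst p * a p m.
Proof.
move=> p0; have C0 := dyadic_cst_gt0 p0.
have CE : dyadic_cst p * (1 - 2^-1 `^ p) = 1.
  by rewrite mulVf// gt_eqF// -invr_gt0.
have key k : a p k + dyadic_cst p * a p (k - 1) = dyadic_cst p * a p k.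
  rewrite aS; transitivity (dyadic_cst p * (1 - 2^-1 `^ p) * a p k +
    dyadic_cst p * (a p k * 2^-1 `^ p)); last by ring.
  by rewrite CE mul1r.
elim: s m => [|l s IH] m; rewrite big_cons.
  by move=> _; rewrite big_nil -key lerD2l mulr_ge0// ltW.
move=> /=/andP[lm /IH h]; rewrite -key lerD2l (le_trans h)//.
by rewrite ler_wpM2l ?(ltW C0)// le_a// lerBrDr -ltzD1 ltrD2r.
Qed.

(** The largest term is at most [y `^ p], and the others are among the terms of
    a geometric series that starts from it. *)
Lemma sum_dyadic_lt p y s : 0 < p -> 0 <= y -> uniq s ->
  \sum_(k <- s | 2 ^ k < y) (2 ^ k) `^ p <= dyadic_cst p * y `^ p.
Proof.
move=> p0 y0 us; have C0 := dyadic_cst_gt0 p0.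
rewrite -big_filter; set t := [seq k <- s | _].
have tP : perm_eq t (rev (sort <=%O t)).
  by rewrite perm_sym perm_rev perm_sort.
have : sorted >%O (rev (sort <=%O t)).
  rewrite rev_sorted (_ : sorted _ _ = sorted <%O (sort <=%O t))//.
  by rewrite sort_lt_sorted filter_uniq.
rewrite (perm_big _ tP)/=; have := perm_mem tP.
case: (rev _) => [_ _|m l lt /(sum_sorted p0) h].
  by rewrite big_nil mulr_ge0 ?powR_ge0// ltW.
apply: le_trans h _; rewrite ler_wpM2l ?(ltW C0)//.
have : m \in t by rewrite lt mem_head.
rewrite mem_filter => /andP[my _].
by rewrite ge0_ler_powR ?nnegrE ?exprz_ge0 ?(ltW p0)// ltW.
Qed.

End dyadic_sums.

Section subadditivity.
Context (R : realType).

(** A fraction [z / (x + y)] in [[0, 1]] is at most its own power of exponent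
    [p]; add this up for [z = x] and [z = y]. *)
Lemma powR_subadditive (p x y : R) : 0 < p -> p <= 1 -> 0 <= x -> 0 <= y ->
  (x + y) `^ p <= x `^ p + y `^ p.
Proof.
move=> p0 p1 x0 y0; have [->|xy0] := eqVneq (x + y) 0.
  by rewrite powR0 ?gt_eqF// addr_ge0 ?powR_ge0.
have s0 : 0 < x + y by rewrite lt_neqAle eq_sym xy0 addr_ge0.
have frac z : 0 <= z -> z <= x + y -> (x + y) `^ p * (z / (x + y)) <= z `^ p.
  move=> z0 zs; rewrite -[in leRHS](divfK xy0 z) powRM ?divr_ge0 ?(ltW s0)//.
  rewrite mulrC ler_wpM2r ?powR_ge0//.
  have [->|zn0] := eqVneq z 0; first by rewrite mul0r powR_ge0.
  rewrite -[leLHS]powRr1 ?divr_ge0 ?(ltW s0)//.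
  rewrite ger_powR// ?divr_gt0//?ler_pdivrMr ?mul1r//.
  by rewrite lt_neqAle eq_sym zn0.
apply: le_trans (lerD (frac x x0 _) (frac y y0 _)); last 2 first.
- by rewrite lerDl.
- by rewrite lerDr.
by rewrite -mulrDr -mulrDl divff// mulr1.
Qed.

Local Open Scope ereal_scope.

Lemma le_poweR (a b : \bar R) (e : R) : (0 <= e)%R -> 0 <= a -> a <= b ->
  a `^ e <= b `^ e.
Proof.
move=> e0 a0 ab; apply: gt0_ler_poweR => //; rewrite in_itv/= leey andbT//.
exact: le_trans ab.
Qed.

Lemma poweR_nneseries (p : R) (x : nat -> \bar R) n : (0 < p)%R -> (p <= 1)%R ->
  (forall j, 0 <= x j) ->
  (\sum_(n <= j <oo) x j) `^ p <= \sum_(n <= j <oo) (x j) `^ p.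
Proof.
move=> p0 p1 x0.
have pn0 : p != 0%R by rewrite gt_eqF.
have add_le (a b : \bar R) : 0 <= a -> 0 <= b ->
    (a + b) `^ p <= a `^ p + b `^ p.
  case: a b => [a| |] [b| |]// a0 b0; rewrite ?poweRyr ?gt_eqF//=.
  by rewrite lee_fin powR_subadditive.
have finite m : (\sum_(n <= j < m) x j) `^ p <= \sum_(n <= j < m) (x j) `^ p.
  have : 0 <= \sum_(n <= j < m) x j /\
      (\sum_(n <= j < m) x j) `^ p <= \sum_(n <= j < m) (x j) `^ p.
    elim/big_ind2 : _ => [|a b c e [a0 ab] [c0 ce]|j _].
    - by rewrite poweR0r ?gt_eqF.
    - split; first exact: adde_ge0.
      by rewrite (le_trans (add_le _ _ a0 c0))// leeD.
    - by split.
  by case.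
have term m : \sum_(n <= j < m) x j <= (\sum_(n <= j <oo) (x j) `^ p) `^ p^-1.
  have s0 : 0 <= \sum_(n <= j < m) x j by exact: sume_ge0.
  rewrite -[leLHS]poweRe1// -(mulfV pn0) poweRrM.
  apply: le_poweR; rewrite ?invr_ge0 ?(ltW p0) ?poweR_ge0//.
  apply: le_trans (finite m) _; apply: nneseries_lim_ge => j _.
  by move=> _; exact: poweR_ge0.
have T0 : 0 <= \sum_(n <= j <oo) (x j) `^ p.
  by apply: nneseries_ge0 => j _ _; exact: poweR_ge0.
rewrite -[leRHS]poweRe1// -(mulVf pn0) poweRrM.
apply: le_poweR; first exact: ltW.
  by apply: nneseries_ge0 => j _ _; exact: x0.
apply: lime_le; first by apply: is_cvg_nneseries => j _ _; exact: x0.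
by apply: nearW => m; exact: term.
Qed.

End subadditivity.

(** * Integral estimates *)

Section integrals.
Context (R : realType) (d : measure_display) (T : measurableType d).
Variable mu : {measure set T -> \bar R}.
Implicit Types (p theta : R).
Local Open Scope ereal_scope.

Lemma measurable_bump (M : R) (B : set T) : measurable B ->
  measurable_fun setT (fun x => (M * \1_B x)%:E).
Proof.
by move=> mB; apply/measurable_EFinP/measurable_funM.
Qed.

Lemma measurable_bumps (M : nat -> R) (B : nat -> set T) :
  (forall j, (0 <= M j)%R) -> (forall j, measurable (B j)) ->
  measurable_fun setT (fun x => \sum_(0 <= j <oo) (M j * \1_(B j) x)%:E).
Proof.
move=> M0 mB; apply: ge0_emeasurable_sum => //= k *.
- by rewrite lee_fin mulr_ge0.
- exact: measurable_bump.
Qed.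

Lemma measurable_superlevel (w : T -> R) (y : R) : measurable_fun setT w ->
  measurable [set x | (y < w x)%R].
Proof.
move=> mw; rewrite (_ : [set x | _] = setT `&` w @^-1` `]y, +oo[); last first.
  by apply/seteqP; split => x /=; rewrite in_itv/= andbT// => -[].
exact: mw.
Qed.

Lemma integral_bumps p (M : nat -> R) (B : nat -> set T) :
  (0 < p)%R -> (p <= 1)%R ->
  (forall j, (0 <= M j)%R) -> (forall j, measurable (B j)) ->
  \int[mu]_x (\sum_(0 <= j <oo) (M j * \1_(B j) x)%:E) `^ p <=
  \sum_(0 <= j <oo) (M j `^ p)%:E * mu (B j).
Proof.
move=> p0 p1 M0 mB; have pn0 : p != 0%R by rewrite gt_eqF.
have bumpE j x : (M j * \1_(B j) x)%:E `^ p = (M j `^ p * \1_(B j) x)%:E.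
  rewrite poweR_EFin powRM// indicE; congr (_ * _)%:E.
  by case: (_ \in _); rewrite ?powR1 ?powR0.
apply: (@le_trans _ _
  (\int[mu]_x \sum_(0 <= j <oo) (M j `^ p * \1_(B j) x)%:E)).
  apply: ge0_le_integral => //.
  - by move=> x _; exact: poweR_ge0.
  - by apply: (measurableT_comp (measurable_poweR p)); exact: measurable_bumps.
  - by apply: measurable_bumps => // j; exact: powR_ge0.
  - move=> x _; under [leRHS]eq_eseriesr do rewrite -bumpE.
    by apply: poweR_nneseries => // j; rewrite lee_fin mulr_ge0.
rewrite integral_nneseries//.
- apply: lee_nneseries => [j _ _|j _].
    by apply: integral_ge0 => x _; rewrite lee_fin mulr_ge0// powR_ge0.
  under eq_integral do rewrite EFinM.
  rewrite ge0_integralZl_EFin//; last 2 first.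
  - exact/measurable_EFinP/measurable_indic.
  - exact: powR_ge0.
  by rewrite integral_indic// setIT.
- by move=> j; exact: measurable_bump.
- by move=> j x _; rewrite lee_fin mulr_ge0// powR_ge0.
Qed.

Lemma esum_dyadic_measure_le p (w : T -> R) : (0 < p)%R ->
  measurable_fun setT w -> (forall x, (0 <= w x)%R) ->
  \esum_(k in [set: int]) (((2 ^ k) `^ p)%:E * mu [set x | (2 ^ k < w x)%R]) <=
  (dyadic_cst p)%:E * \int[mu]_x ((w x) `^ p)%:E.
Proof.
move=> p0 mw w0; have C0 := dyadic_cst_gt0 p0.
have mL k : measurable [set x | (2 ^ k < w x)%R].
  exact: measurable_superlevel.
apply: ge_ereal_sup => _ [J [finJ _] <-].
rewrite fsbig_finite//=.
rewrite -ge0_integralZl_EFin//; last 3 first.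
- by move=> x _; rewrite lee_fin powR_ge0.
- by apply/measurable_EFinP; apply: (measurableT_comp (measurable_powR p)).
- exact: ltW.
rewrite (eq_bigr (fun k => \int[mu]_x
    ((2 ^ k) `^ p * \1_[set x | (2 ^ k < w x)%R] x)%:E)); last first.
  move=> k _; under eq_integral do rewrite EFinM.
  rewrite ge0_integralZl_EFin ?powR_ge0//; last first.
    exact/measurable_EFinP/measurable_indic.
  by rewrite integral_indic// setIT.
rewrite -ge0_integral_sum//; last 2 first.
- by move=> k; exact: measurable_bump.
- by move=> k x _; rewrite lee_fin mulr_ge0// powR_ge0.
apply: ge0_le_integral => //.
- by move=> x _; apply: sume_ge0 => k _; rewrite lee_fin mulr_ge0// powR_ge0.
- by apply: emeasurable_sum => k; exact: measurable_bump.
- apply/measurable_EFinP/measurable_funM => //.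
  exact: (measurableT_comp (measurable_powR p)).
- move=> x _; rewrite sumEFin -EFinM lee_fin.
  apply: le_trans (sum_dyadic_lt p0 (w0 x) (finmap.fset_uniq (fset_set J))).
  rewrite [leRHS]big_mkcond/=; apply: ler_sum => k _.
  rewrite indicE; case: ifPn => kw; first by rewrite mem_set// mulr1.
  by rewrite memNset ?mulr0//=; exact/negP.
Qed.

(** Applied with [theta = 1 / tau], this puts the size term of the Hajlasz norm
    in integral form for all [tau], the value [+oo] included. *)
Lemma Lp_normZ p theta (f : T -> R) : (0 < p)%R -> (0 <= theta)%R ->
  measurable_fun setT f ->
  theta%:E * 'N[mu]_p%:E[EFin \o f] =
    (\int[mu]_x ((theta * `|f x|) `^ p)%:E) `^ p^-1.
Proof.
move=> p0 t0 mf; rewrite unlock /Lnorm.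
have -> : \int[mu]_x ((theta * `|f x|) `^ p)%:E =
    (theta `^ p)%:E * \int[mu]_x (`|(EFin \o f) x| `^ p).
  under eq_integral do rewrite powRM// EFinM.
  rewrite ge0_integralZl_EFin ?powR_ge0//.
    apply/measurable_EFinP/(measurableT_comp (measurable_powR p)).
    exact/measurableT_comp.
rewrite poweRM ?lee_fin ?powR_ge0//; last first.
  by apply: integral_ge0 => x _; exact: poweR_ge0.
by rewrite poweR_EFin -powRrM mulfV ?powRr1// gt_eqF.
Qed.

End integrals.

(** * Telescoping along an enumeration *)

Section enumerated_telescope.
Context (R : realType) (e : nat -> int * nat) (e' : int * nat -> nat).
Hypotheses (eK : cancel e e') (e'K : cancel e' e).
Variables (phi : int -> R) (be ga : int * nat -> R) (Phi : R).
Hypothesis increment : forall k, exists n0, forall n, (n0 <= n)%N ->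
  \sum_(i < n) be (k, i : nat) = phi (k + 1) - phi k.
Hypothesis phi_top : exists k0 : nat, forall k : nat, (k0 <= k)%N ->
  phi k%:Z = Phi.
Hypothesis phi_bot : forall eps : R, 0 < eps -> exists k0 : nat,
  forall k : nat, (k0 <= k)%N -> `|phi (- k%:Z)| <= eps.
Hypothesis be_ga : forall t, `|be t| <= ga t.

Let box (N I : nat) : seq (int * nat) :=
  [seq (i%:Z - N%:Z, l) | i <- iota 0 (N + N), l <- iota 0 I].

Let mem_box N I k l :
  ((k, l) \in box N I) = ((- N%:Z <= k) && (k < N%:Z) && (l < I)%N).
Proof.
apply/allpairsP/idP => [[[i j] /= []]|/andP[/andP[N1 N2] lI]].
  by rewrite !mem_iota => iN jI [-> ->]; lia.
exists (absz (k + N%:Z), l); rewrite !mem_iota /=; split; [lia|lia|].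
by congr pair; lia.
Qed.

Let uniq_box N I : uniq (box N I).
Proof.
apply: allpairs_uniq; rewrite ?iota_uniq// => -[i l] [j m] _ _ /= [].
by move=> ij ->; congr pair; lia.
Qed.

Let sum_box N I :
  (forall i, (i < N + N)%N -> \sum_(l < I) be (i%:Z - N%:Z, l : nat) =
     phi (i%:Z - N%:Z + 1) - phi (i%:Z - N%:Z)) ->
  \sum_(t <- box N I) be t = phi N%:Z - phi (- N%:Z).
Proof.
move=> incr; rewrite big_allpairs_dep/=.
rewrite (eq_big_seq (fun i : nat => phi (i.+1%:Z - N%:Z) - phi (i%:Z - N%:Z))).
  rewrite -[X in iota 0 X]subn0 -/(index_iota 0 (N + N)).
  rewrite telescope_sumr//; congr (phi _ - phi _); lia.
move=> i; rewrite mem_iota/= => iN.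
rewrite -[X in iota 0 X]subn0 -/(index_iota 0 I) big_mkord incr//.
by congr (phi _ - _); lia.
Qed.

(** Rectangular partial sums of the double series telescope to [Phi] up to a
    vanishing error; comparing them with the enumerated partial sums costs only
    terms of index at least [n]. *)
Lemma enumerated_telescope n :
  ((`|Phi - \sum_(j < n) be (e j)|)%:E <=
     \sum_(0 <= j <oo) (ga (e (j + n)%N))%:E)%E.
Proof.
have ga0 t : 0 <= ga t by exact: le_trans (be_ga t).
apply/lee_addgt0Pr => eps eps0.
have [k0 top] := phi_top; have [k1 bot] := phi_bot eps0.
have [n0 incr] := choice increment.
pose N := (k0 + k1 + \max_(j < n) absz (e j).1 + 1)%N.
pose I := (\max_(i < N + N) n0 (i%:Z - N%:Z)%R + \max_(j < n) (e j).2 + 1)%N.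
pose m := (n + \max_(t <- box N I) (e' t).+1)%N.
have boxE : \sum_(t <- box N I) be t = Phi - phi (- N%:Z).
  rewrite sum_box; first by rewrite top// /N; lia.
  move=> i iN; apply: incr; rewrite /I -addnA; apply: leq_trans (leq_addr _ _).
  exact: (leq_bigmax (Ordinal iN)).
have head j : (j < n)%N -> e j \in box N I.
  move=> jn.
  have := leq_bigmax (F := fun j : 'I_n => absz (e j).1) (Ordinal jn).
  have := leq_bigmax (F := fun j : 'I_n => (e j).2) (Ordinal jn).
  case: (e j) => k l /= lI kN; rewrite mem_box; apply/andP; split; last first.
    by rewrite /I addn1 ltnS (leq_trans lI)// leq_addl.
  move: kN; rewrite /N; move: (\max_(j < n) _)%N => u kN.
  by lia.
have boxP : perm_eq (box N I) [seq t <- map e (index_iota 0 m) | t \in box N I].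
  apply: uniq_perm; rewrite ?uniq_box ?filter_uniq//.
    by rewrite map_inj_uniq ?iota_uniq//; exact: can_inj eK.
  move=> t; rewrite mem_filter; case: (boolP (t \in box N I)) => //= tb.
  apply/esym/mapP; exists (e' t) => //; rewrite mem_index_iota /=.
  rewrite /m; apply: leq_trans (leq_addl _ _).
  exact: (leq_bigmax_seq (F := fun t => (e' t).+1) _ tb).
have nm : (n <= m)%N by exact: leq_addr.
have PhiE : Phi - \sum_(j < n) be (e j) =
    phi (- N%:Z) + \sum_(n <= j < m | e j \in box N I) be (e j).
  have -> : Phi = phi (- N%:Z) + \sum_(t <- box N I) be t.
    by rewrite boxE addrC subrK.
  rewrite -addrA; congr (_ + _).
  rewrite (perm_big _ boxP)/= big_filter big_map (big_cat_nat (n := n))//=.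
  rewrite (_ : \sum_(0 <= j < n | _) _ = \sum_(j < n) be (e j)); last first.
    by rewrite big_mkord; apply: eq_bigl => j; rewrite head.
  by rewrite addrAC subrr add0r.
rewrite PhiE (@le_trans _ _ (eps + \sum_(n <= j < m) ga (e j))%:E)//.
  rewrite lee_fin (le_trans (ler_normD _ _))// lerD//.
    by apply: bot; rewrite /N; lia.
  rewrite (le_trans (ler_norm_sum _ _ _))// big_mkcond/=.
  by apply: ler_sum => j _; case: ifP.
rewrite EFinD addeC leeD2r//.
rewrite -sumEFin.
rewrite (nneseries_addn n (f := fun j => (ga (e j))%:E)); last first.
  by move=> ?; rewrite lee_fin.
by apply: nneseries_lim_ge => j _ _; rewrite lee_fin.
Qed.

End enumerated_telescope.

(** * Atoms and the Hajlasz norm *)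

Section atoms.
Context (R : realType) (d : measure_display) (X : measurableMetricType d R).
Variable sigma : {measure set X -> \bar R}.
Hypothesis doubling : doubling_measure sigma.

Lemma inve_fin_num (tau : \bar R) : (0 < tau)%E ->
  (tau^-1)%E = (fine tau^-1)%:E /\ 0 <= fine tau^-1.
Proof.
case: tau => [t|_|//]; last by rewrite invey.
by rewrite lte_fin => t0; rewrite inver gt_eqF//= invr_ge0 ltW.
Qed.

Lemma Lp_normy_le (M : R) (f : X -> R) : 0 <= M ->
  (forall x, `|f x| <= M) -> (Lp_norm sigma +oo f <= M%:E)%E.
Proof.
move=> M0 fM; rewrite /Lp_norm unlock /Lnorm; case: ifP => // _.
by apply/ess_supP/nearW => x /=; rewrite lee_fin.
Qed.

Lemma vanishing_outside_mball (c : X) (r : R) (b : X -> R) :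
  (forall x, r / 2 <= mdist c x -> b x = 0) ->
  forall x, ~ ball c r x -> b x = 0.
Proof.
move=> b0 x; rewrite ballEmdist /= => /negP; rewrite -leNgt => rx.
by apply: b0; have := mdist_ge0 c x; lra.
Qed.

(** The gradient is the Lipschitz constant on the ball and [0] outside; the gap
    between [r / 2] and [r] keeps the closed support inside the open ball. *)
Lemma lipschitz_atom (tau : \bar R) (p : R) (c : X) (r : R) (a : X -> R) :
  (0 < tau)%E -> 0 < r ->
  lipschitz_with (fine (sigma (ball c r)) `^ (- p^-1)) a ->
  (forall x, r / 2 <= mdist c x -> a x = 0) ->
  (forall x, fine tau^-1 * `|a x| <= fine (sigma (ball c r)) `^ (- p^-1)) ->
  lipschitz_function a /\ hajlasz_atom sigma tau +oo%E p a.
Proof.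
move=> tau0 r0; set s := fine _; set K := s `^ _ => Ka a0 aK.
have K0 : 0 <= K by exact: powR_ge0.
have sfin := measure_mball_fin_num doubling c r0.
have sE : sigma (ball c r) = s%:E by rewrite fineK.
have s0 : 0 < s by rewrite -lte_fin -sE (measure_mball_gt0 doubling).
have Kpos : 0 < K by exact: powR_gt0.
have mB := measurable_mball doubling c r.
have mg : measurable_fun setT (fun x => K * \1_(ball c r) x).
  by apply: measurable_funM => //; exact: measurable_indic.
have gK x : `|K * \1_(ball c r) x| <= K.
  by rewrite ger0_norm ?mulr_ge0// ler_piMr// indicE; case: (_ \in _).
split; first by exists K.
split; first exact: (measurable_lipschitz_with doubling Ka).
exists c, r, (fun x => K * \1_(ball c r) x).
have expE : fine ((+oo : \bar R)^-1)%E - p^-1 = - p^-1 by rewrite invey/= sub0r.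
split => //.
- split.
    split => //; first by move=> x; rewrite mulr_ge0.
    exists set0; first exact: negligible_set0.
    move=> x y _ _; apply: lipschitz_bump => //.
    exact: vanishing_outside_mball.
  apply/andP; split; apply/mem_set => //=.
  by rewrite /finite_norm (le_lt_trans (Lp_normy_le K0 gK))// ltry.
- move=> y /(_ (ball y (r / 2)))[|z [/= az yz]].
    by apply: nbhsx_ballx; rewrite divr_gt0.
  rewrite ballEmdist/=; apply: le_lt_trans (metric_triangle c z y) _.
  have cz : mdist c z < r / 2.
    by rewrite ltNge; apply: contra az => /a0 ->.
  move: yz; rewrite ballEmdist/= => yz.
  by rewrite [mdist z y]metric_sym (splitr r) ltrD.
- by rewrite expE sE poweR_EFin; exact: Lp_normy_le.
- rewrite expE sE poweR_EFin -/K.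
  move: tau0 aK; case: tau => [t|_ _|//]; last first.
    by rewrite gt0_mulye ?leey ?lte_fin.
  rewrite lte_fin => t0; rewrite inver gt_eqF//= => aK.
  rewrite -EFinM; apply: Lp_normy_le; first by rewrite mulr_ge0// ltW.
  by move=> x; rewrite mulrC -ler_pdivrMr// mulrC.
Qed.

(** A bump supported in a ball is a multiple of an atom; a void bump, with
    radius [0], is [0] times the trivial atom. *)
Lemma normalized_atom (tau : \bar R) (p M : R) (c : X) (r : R) (b : X -> R) :
  (0 < tau)%E -> 0 < p -> 0 < M -> 0 <= r ->
  lipschitz_with M b -> (forall x, r / 2 <= mdist c x -> b x = 0) ->
  (forall x, fine tau^-1 * `|b x| <= M) ->
  exists (a : X -> R) (lam : R),
    [/\ lipschitz_function a /\ hajlasz_atom sigma tau +oo%E p a,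
        forall x, lam * a x = b x
      & ((`|lam| `^ p)%:E = (M `^ p)%:E * sigma (ball c r))%E].
Proof.
move=> tau0 p0 M0; rewrite le_eqVlt => /predU1P[<-|r0] Mb b0 bM.
  exists (cst 0), 0; split.
  - apply: (lipschitz_atom (c := point) (r := 1)) => //.
      by apply: lipschitz_with_cst; exact: powR_ge0.
    by move=> x; rewrite normr0 mulr0 powR_ge0.
  - by move=> x; rewrite mul0r b0// mul0r mdist_ge0.
  - rewrite normr0 powR0 ?gt_eqF// (_ : ball c 0 = set0) ?measure0 ?mule0//.
    by rewrite -subset0 => y; rewrite ballEmdist/= ltNge mdist_ge0.
set s := fine (sigma (ball c r)).
have sE : sigma (ball c r) = s%:E.
  by rewrite fineK// (measure_mball_fin_num doubling).
have s0 : 0 < s by rewrite -lte_fin -sE (measure_mball_gt0 doubling).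
pose lam := M * s `^ p^-1.
have lam0 : 0 < lam by rewrite mulr_gt0// powR_gt0.
have lamE : lam^-1 * M = s `^ (- p^-1).
  rewrite /lam invfM mulrAC mulVf ?mul1r ?gt_eqF//.
  by rewrite powRN.
have il0 : 0 <= lam^-1 by rewrite invr_ge0 ltW.
exists (fun x => lam^-1 * b x), lam; split.
- apply: (lipschitz_atom (c := c) (r := r)) => //.
  + rewrite -/s -lamE -[X in X * M](ger0_norm il0).
    exact: lipschitz_withZ.
  + by move=> x /b0 ->; rewrite mulr0.
  + move=> x; rewrite -/s -lamE normrM (ger0_norm il0) mulrCA.
    by rewrite ler_wpM2l.
- by move=> x; rewrite mulrA mulfV ?mul1r// gt_eqF.
- rewrite sE -EFinM ger0_norm ?ltW// powRM ?powR_ge0 ?ltW//.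
  by rewrite -powRrM mulVf ?gt_eqF// powRr1// ltW.
Qed.

(** One function [h] controls both terms of the norm, whence the factor [2]. It
    takes extended values, since a series of bumps converges only almost
    everywhere. *)
Lemma hajlasz_norm_le (tau : \bar R) (p : R) (F : X -> R) (h : X -> \bar R)
    (N : set X) : (0 < tau)%E -> 0 < p ->
  measurable_fun setT F -> measurable_fun setT h -> (forall x, (0 <= h x)%E) ->
  sigma.-negligible N ->
  (forall x y, ~ N x -> ~ N y ->
    ((`|F x - F y|)%:E <= (mdist x y)%:E * (h x + h y))%E) ->
  (forall x, ~ N x -> ((fine tau^-1 * `|F x|)%:E <= h x)%E) ->
  (\int[sigma]_x (h x) `^ p < +oo)%E ->
  (hajlasz_norm sigma p tau F <= 2%:E * (\int[sigma]_x (h x) `^ p) `^ p^-1)%E.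
Proof.
move=> tau0 p0 mF mh h0 NN Fh Fsize hoo.
have [tauE t0] := inve_fin_num tau0.
have mhp : measurable_fun setT (fun x => (h x `^ p)%E).
  exact: (measurableT_comp (measurable_poweR p)).
have hp0 x : (0 <= h x `^ p)%E by exact: poweR_ge0.
have ih0 : (0 <= \int[sigma]_x (h x) `^ p)%E by exact: integral_ge0.
have [Z [mZ Z0 hZ]] :
    {ae sigma, forall x, setT x -> (h x `^ p)%E \is a fin_num}.
  apply: integrable_ae => //; apply/integrableP; split => //.
  by under eq_integral do rewrite gee0_abs//.
rewrite /hajlasz_norm (_ : 2%:E = 1 + 1)%E; last by rewrite -EFinD.
rewrite ge0_muleDl// mul1e; apply: leeD.
  rewrite tauE /Lp_norm Lp_normZ//.
  apply: le_poweR; rewrite ?invr_ge0 ?(ltW p0)//.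
    by apply: integral_ge0 => x _; rewrite lee_fin powR_ge0.
  apply: ae_ge0_le_integral => //.
  - by move=> x _; rewrite lee_fin powR_ge0.
  - apply/measurable_EFinP; apply: (measurableT_comp (measurable_powR p)).
    by apply: measurable_funM => //; exact: measurableT_comp.
  - case: NN => N' [mN' N'0 NN']; exists N'; split => // x /= hx; apply: NN'.
    apply: contrapT => Nx; apply: hx => _; rewrite -poweR_EFin.
    by apply: le_poweR; rewrite ?lee_fin ?mulr_ge0 ?(ltW p0)//; exact: Fsize.
apply: (@le_trans _ _ (Lp_norm sigma p%:E (fine \o h))); last first.
  rewrite /Lp_norm -[leLHS]mul1e Lp_normZ//; last first.
    by apply: measurableT_comp => //; exact: measurable_fine.
  apply: le_poweR; rewrite ?invr_ge0 ?(ltW p0)//.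
    by apply: integral_ge0 => x _; rewrite lee_fin powR_ge0.
  apply: ge0_le_integral => //.
  - apply/measurable_EFinP; apply: (measurableT_comp (measurable_powR p)).
    apply: measurable_funM => //; apply: measurableT_comp => //.
    by apply: measurableT_comp => //; exact: measurable_fine.
  - move=> x _; rewrite mul1r/= -poweR_EFin.
    apply: le_poweR; rewrite ?lee_fin ?(ltW p0)//.
    have := h0 x; case: (h x) => //= [r|]; rewrite ?leey// lee_fin => r0.
    by rewrite ger0_norm.
apply: ereal_inf_lbound; exists (fine \o h) => //; split.
- by apply: measurableT_comp => //; exact: measurable_fine.
- by move=> x /=; rewrite fine_ge0.
- exists (N `|` Z); first by apply: negligibleU => //; exists Z; split.
  have hfin x : ~ Z x -> h x = (fine (h x))%:E.
    move=> Zx; have : (h x `^ p)%E \is a fin_num.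
      by apply: contrapT => hx; apply: Zx; apply: hZ => /= /(_ Logic.I).
    have := h0 x; case: (h x) => //= _; by rewrite ?poweRyr ?gt_eqF.
  move=> x y /not_orP[Nx Zx] /not_orP[Ny Zy] /=.
  by have := Fh x y Nx Ny; rewrite (hfin x)// (hfin y)//= -EFinM lee_fin.
Qed.

End atoms.

(** * Decomposition of a function into bumps *)

Lemma esumZl_le (R : realType) (T : choiceType) (c : R) (a : T -> \bar R) :
  0 <= c -> (forall t, (0 <= a t)%E) ->
  (\esum_(t in [set: T]) (c%:E * a t) <= c%:E * \esum_(t in [set: T]) a t)%E.
Proof.
move=> c0 a0; apply: ge_ereal_sup => _ [J [finJ _] <-].
rewrite fsbig_finite//= -ge0_sume_distrr// lee_wpmul2l ?lee_fin//.
by apply: ereal_sup_ubound; exists J => //; rewrite fsbig_finite.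
Qed.

Lemma int_nat_enumeration :
  exists (e : nat -> int * nat) (e' : int * nat -> nat),
  cancel e e' /\ cancel e' e.
Proof.
have /card_set_bijP[f] : ([set: int * nat] #= [set: nat])%card.
  apply: eq_card_nat; first exact: countableP.
  move=> /(finite_image snd) fin; apply: infinite_nat.
  by apply: sub_finite_set fin => n _; exists (0, n).
by rewrite setTT_bijective => -[g fK gK]; exists g, f.
Qed.

Lemma exprz_nat_ge (R : realType) (y : R) :
  exists k0 : nat, forall k : nat, (k0 <= k)%N -> y <= 2 ^ k%:Z.
Proof.
exists (Num.truncn `|y|).+1 => k kk; apply: le_trans (ler_norm y) _.
apply: (@le_trans _ _ k%:R).
  by rewrite (le_trans (ltW (truncnS_gt _)))// ler_nat.
by rewrite -exprnP -natrX ler_nat ltnW// ltn_expl.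
Qed.

Lemma exprz_opp_small (R : realType) (y eps : R) : 0 < eps ->
  exists k0 : nat, forall k : nat, (k0 <= k)%N -> y * 2 ^ (- k%:Z) <= eps.
Proof.
move=> eps0; have [k0 h] := exprz_nat_ge (y / eps); exists k0 => k /h.
by rewrite ler_pdivrMr// -invr_expz ler_pdivrMr ?exprz_gt0// mulrC.
Qed.

Section approximation.
Context (R : realType) (X : metricType R).

(** Where [w <= 2 ^ k], the Hajlasz inequality is a Lipschitz bound with
    constant [2 * 2 ^ k]: extend from there. *)
Lemma lipschitz_approximations (theta : R) (f w g : X -> R) (N : set X) :
  0 <= theta ->
  (forall x y, ~ N x -> ~ N y -> `|f x - f y| <= mdist x y * (g x + g y)) ->
  (forall x, g x <= w x) -> (forall x, theta * `|f x| <= w x) ->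
  exists phi : int -> X -> R,
  [/\ forall k, lipschitz_with (2 * 2 ^ k) (phi k),
      forall k x, theta * `|phi k x| <= 2 ^ k
    & forall k x, ~ N x -> w x <= 2 ^ k -> phi k x = f x].
Proof.
move=> t0 fg gw fw.
suff /choice[phi phiP] : forall k : int, exists F : X -> R,
    [/\ lipschitz_with (2 * 2 ^ k) F, forall x, theta * `|F x| <= 2 ^ k
      & forall x, ~ N x -> w x <= 2 ^ k -> F x = f x].
  by exists phi; split => k; case: (phiP k).
move=> k; pose E := [set x | ~ N x /\ w x <= 2 ^ k].
have a0 : 0 <= 2 ^ k :> R by exact: exprz_ge0.
have K0 : 0 <= 2 * 2 ^ k :> R by rewrite mulr_ge0.
have [||F [F1 F2 F3]] := @bounded_lipschitz_extension _ _ (2 * 2 ^ k) theta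
    (2 ^ k) E f K0 t0 a0.
- move=> x y [Nx wx] [Ny wy]; apply: le_trans (fg x y Nx Ny) _.
  rewrite mulrC ler_wpM2r ?mdist_ge0//.
  by have := gw x; have := gw y; lra.
- by move=> x [_ wx]; exact: le_trans (fw x) wx.
- by exists F; split => // x Nx wx; exact: F3.
Qed.

Lemma lipschitz_increment (phi : int -> X -> R) (k : int) :
  (forall k, lipschitz_with (2 * 2 ^ k) (phi k)) ->
  lipschitz_with (6 * 2 ^ k) (fun x => phi (k + 1) x - phi k x).
Proof.
move=> phiL; have -> : 6 * 2 ^ k = 2 * 2 ^ (k + 1) + 2 * 2 ^ k :> R.
  by rewrite expfzDr ?pnatr_eq0// expr1z; ring.
exact: lipschitz_withB.
Qed.

End approximation.

Section decomposition.
Context (R : realType) (d : measure_display) (X : measurableMetricType d R).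
Variable sigma : {measure set X -> \bar R}.
Hypothesis doubling : doubling_measure sigma.

Lemma measure_increment_support (w u : X -> R) (N : set X) (K y : R) :
  lipschitz_with K u -> measurable_fun setT w -> sigma.-negligible N ->
  (forall x, ~ N x -> w x <= y -> u x = 0) ->
  (sigma [set x | u x != 0%R] <= sigma [set x | (y < w x)%R])%E.
Proof.
move=> Ku mw [N' [mN' N'0 NN']] u0.
have mL : measurable [set x | y < w x] by exact: measurable_superlevel.
apply: (@le_trans _ _ (sigma ([set x | y < w x] `|` N'))).
  apply: le_measure; rewrite ?inE.
  - by apply: (measurable_open doubling); exact: open_support Ku.
  - exact: measurableU.
  - move=> x /= ux; have [wx|wx] := ltP y (w x); first by left.
    right; apply: NN'; apply: contrapT => Nx; move: ux.
    by rewrite u0// eqxx.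
by rewrite measureU0.
Qed.

(** The constant is [60 = 10 * 6], as cutting into bumps multiplies by [10] the
    Lipschitz constant [6 * 2 ^ k] of the increment [phi (k + 1) - phi k]. The
    support of this increment lies in [{w > 2 ^ k}] up to a null set, so that
    the balls of each level sum to at most [A * sigma {w > 2 ^ k}]. *)
Lemma bump_decomposition : exists2 A : R, 0 < A &
  forall (theta p : R) (w : X -> R) (phi : int -> X -> R) (N : set X),
  0 < p -> measurable_fun setT w -> (forall x, 0 <= w x) ->
  sigma.-negligible N ->
  (forall k, lipschitz_with (2 * 2 ^ k) (phi k)) ->
  0 <= theta -> (forall k x, theta * `|phi k x| <= 2 ^ k) ->
  (forall k x, ~ N x -> w x <= 2 ^ k -> phi (k + 1) x = phi k x) ->
  (\int[sigma]_x ((w x) `^ p)%:E < +oo)%E ->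
  exists (b : int * nat -> X -> R) (c : int * nat -> X) (rho : int * nat -> R),
  [/\ forall t, lipschitz_with (60 * 2 ^ t.1) (b t),
      forall t, 0 <= rho t /\ forall x, rho t / 2 <= mdist (c t) x -> b t x = 0,
      forall t x, theta * `|b t x| <= 60 * 2 ^ t.1,
      forall k x, exists n0, forall n, (n0 <= n)%N ->
        \sum_(i < n) b (k, i : nat) x = phi (k + 1) x - phi k x
    & (\esum_(t in [set: int * nat])
         (((60 * 2 ^ t.1) `^ p)%:E * sigma (ball (c t) (rho t))) <=
       (60 `^ p * A * dyadic_cst p)%:E * \int[sigma]_x ((w x) `^ p)%:E)%E].
Proof.
have [A A0 hA] := lipschitz_decomposition doubling; exists A => //.
move=> theta p w phi N p0 mw w0 NN phiL t0 phiB phiN woo.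
pose u k x := phi (k + 1) x - phi k x.
have uL k : lipschitz_with (6 * 2 ^ k) (u k) by exact: lipschitz_increment.
have dyadic := esum_dyadic_measure_le sigma p0 mw w0.
have suppu k : (sigma [set x | u k x != 0%R] <=
    sigma [set x | (2 ^ k < w x)%R])%E.
  apply: (measure_increment_support (uL k) mw NN) => x Nx wx.
  by rewrite /u phiN// subrr.
have suppoo k : (sigma [set x | u k x != 0%R] < +oo)%E.
  apply: le_lt_trans (suppu k) _.
  have a0 : 0 < (2 ^ k) `^ p :> R by rewrite powR_gt0// exprz_gt0.
  have : (((2 ^ k) `^ p)%:E * sigma [set x | (2 ^ k < w x)%R] < +oo)%E.
    have : ((dyadic_cst p)%:E * \int[sigma]_x ((w x) `^ p)%:E < +oo)%E.
      by rewrite lte_mul_pinfty// lee_fin ltW// dyadic_cst_gt0.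
    apply: le_lt_trans.
    apply: le_trans dyadic; apply: esum_ge.
    by exists [set k]; rewrite ?fsbig_set1//; split => //; exact: finite_set1.
  apply: contraTT; rewrite -!leNgt !leye_eq => /eqP ->.
  by rewrite gt0_muley.
have K0 k : 0 < 6 * 2 ^ k :> R by rewrite mulr_gt0// exprz_gt0.
pose P k (z : (nat -> X -> R) * (nat -> X) * (nat -> R)) :=
  [/\ forall i, lipschitz_with (10 * (6 * 2 ^ k)) (z.1.1 i),
      forall i, 0 <= z.2 i /\
        forall x, z.2 i / 2 <= mdist (z.1.2 i) x -> z.1.1 i x = 0,
      forall i x, `|z.1.1 i x| <= 2 * `|u k x|,
      forall x, exists n0, forall n, (n0 <= n)%N ->
        \sum_(i < n) z.1.1 i x = u k x
    & (\sum_(0 <= i <oo) sigma (ball (z.1.2 i) (z.2 i)) <=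
         A%:E * sigma [set x | (u k x != 0)%R])%E].
have /choice[z zP] : forall k, exists z, P k z.
  move=> k; have [b [c [rho h]]] := hA _ _ (K0 k) (uL k) (suppoo k).
  by exists (b, c, rho).
have ME k : 10 * (6 * 2 ^ k) = 60 * 2 ^ k :> R by rewrite mulrA -natrM.
exists (fun t => (z t.1).1.1 t.2), (fun t => (z t.1).1.2 t.2),
  (fun t => (z t.1).2 t.2); split.
- by move=> [k i] /=; rewrite -ME; have [] := zP k.
- by move=> [k i] /=; have [] := zP k.
- move=> [k i] x /=; have [_ _ /(_ i x) bu _ _] := zP k.
  have : theta * `|u k x| <= 2 ^ (k + 1) + 2 ^ k.
    apply: le_trans (lerD (phiB (k + 1) x) (phiB k x)).
    by rewrite -mulrDr ler_wpM2l// ler_normB.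
  rewrite expfzDr ?pnatr_eq0// expr1z.
  have := ler_wpM2l t0 bu; have : 0 < 2 ^ k :> R by rewrite exprz_gt0.
  by rewrite mulrCA; lra.
- by move=> k x; have [_ _ _ /(_ x)] := zP k.
- rewrite -[[set: int * nat]](_ : setT `*`` (fun=> setT) = _); last first.
    by apply/seteqP; split => // -[].
  rewrite -(esum_esum (a := fun k i => (((60 * 2 ^ k) `^ p)%:E *
    sigma (ball ((z k).1.2 i) ((z k).2 i)))%E)); last first.
    by move=> k i _ _; rewrite mule_ge0// lee_fin powR_ge0.
  rewrite EFinM -muleA; apply: le_trans (lee_wpmul2l _ dyadic); last first.
    by rewrite lee_fin mulr_ge0 ?powR_ge0// ltW.
  apply: le_trans (esumZl_le _ _); last 2 first.
  - by rewrite mulr_ge0 ?powR_ge0// ltW.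
  - by move=> k; rewrite mule_ge0// lee_fin powR_ge0.
  apply: le_esum => k _; rewrite -nneseries_esumT; last first.
    by move=> i; rewrite mule_ge0// lee_fin powR_ge0.
  rewrite nneseriesZl// powRM ?exprz_ge0// !EFinM -!muleA.
  rewrite lee_wpmul2l ?lee_fin ?powR_ge0// muleCA.
  rewrite lee_wpmul2l ?lee_fin ?powR_ge0//.
  have [_ _ _ _ h] := zP k; apply: le_trans h _.
  by rewrite lee_wpmul2l// lee_fin ltW.
Qed.

End decomposition.

(** * Convergence in the Hajlasz norm *)

Section convergence.
Context (R : realType) (d : measure_display) (X : measurableMetricType d R).
Variable sigma : {measure set X -> \bar R}.
Local Open Scope ereal_scope.

Lemma hajlasz_norm_ge0 (p : R) (tau : \bar R) (f : X -> R) : 0 < tau ->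
  0 <= hajlasz_norm sigma p tau f.
Proof.
move=> tau0; apply: adde_ge0.
  by rewrite mule_ge0 ?Lnorm_ge0// inve_ge0 ltW.
by apply: le_ereal_inf_tmp => _ [g _ <-]; exact: Lnorm_ge0.
Qed.

(** The norms are at most twice the powers of exponent [1 / p] of the tails of a
    convergent series. *)
Lemma hajlasz_norm_cvg0 (p : R) (tau : \bar R) (F : nat -> X -> R)
    (M : nat -> R) (B : nat -> set X) (N : set X) :
  let h n x := \sum_(0 <= j <oo) (M (j + n)%N * \1_(B (j + n)%N) x)%:E in
  0 < tau -> (0 < p)%R -> (p <= 1)%R ->
  (forall n, measurable_fun setT (F n)) ->
  (forall j, (0 <= M j)%R) -> (forall j, measurable (B j)) ->
  sigma.-negligible N ->
  (forall n x y, ~ N x -> ~ N y ->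
    (`|F n x - F n y|)%:E <= (mdist x y)%:E * (h n x + h n y)) ->
  (forall n x, ~ N x -> (fine tau^-1 * `|F n x|)%:E <= h n x) ->
  \sum_(0 <= j <oo) (M j `^ p)%:E * sigma (B j) < +oo ->
  hajlasz_norm sigma p tau (F n) @[n --> \oo] --> 0.
Proof.
move=> h tau0 p0 p1 mF M0 mB NN Fh Fsize Soo.
have pn0 : p != 0%R by rewrite gt_eqF.
pose term j := (M j `^ p)%:E * sigma (B j).
have term0 j : 0 <= term j by rewrite mule_ge0// lee_fin powR_ge0.
pose tail n := \sum_(0 <= j <oo) term (j + n)%N.
have tail0 n : 0 <= tail n by apply: nneseries_ge0 => j _ _.
have tailE n : tail n = \sum_(n <= j <oo) term j.
  by rewrite /tail nneseries_addn.
have tail_le n : tail n <= tail 0%N.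
  rewrite !tailE (nneseries_split 0 n)// add0n leeDr//.
  exact: sume_ge0.
have tail_fin n : tail n \is a fin_num.
  rewrite (ge0_fin_numE (tail0 n)); apply: (le_lt_trans (tail_le n)).
  by rewrite (tailE 0%N); exact: Soo.
have h0 n x : 0 <= h n x.
  by apply: nneseries_ge0 => j _ _; rewrite lee_fin mulr_ge0.
have hle n : \int[sigma]_x (h n x) `^ p <= tail n.
  by apply: (integral_bumps sigma (M := fun j => M (j + n)%N)
    (B := fun j => B (j + n)%N)).
have ih0 n : 0 <= \int[sigma]_x (h n x) `^ p.
  by apply: integral_ge0 => x _; exact: poweR_ge0.
have norm_le n : hajlasz_norm sigma p tau (F n) <= 2%:E * tail n `^ p^-1.
  apply: le_trans (hajlasz_norm_le (h := h n) tau0 p0 (mF n) _ (h0 n) NN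
    (Fh n) (Fsize n) _) _.
  - exact: measurable_bumps.
  - by apply: le_lt_trans (hle n) _; rewrite -ge0_fin_numE.
  - by rewrite lee_wpmul2l ?lee_fin// le_poweR// invr_ge0 ltW.
have norm_fin n : hajlasz_norm sigma p tau (F n) \is a fin_num.
  rewrite ge0_fin_numE ?hajlasz_norm_ge0//; apply: le_lt_trans (norm_le n) _.
  by rewrite -ge0_fin_numE ?mule_ge0 ?poweR_ge0// fin_numM// fin_num_poweR.
have /fine_cvgP[_ /cvgrPdist_lt tail_cvg] : tail n @[n --> \oo] --> 0.
  rewrite (_ : tail = fun n => \sum_(n <= j <oo) term j); last exact/funext.
  exact: nneseries_tail_cvg.
apply/fine_cvgP; split; first by apply: nearW => n; exact: norm_fin.
apply/cvgrPdist_le => eps eps0.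
have eps2 : (0 < (eps / 2) `^ p)%R by rewrite powR_gt0// divr_gt0.
near=> n.
rewrite sub0r normrN ger0_norm ?fine_ge0 ?hajlasz_norm_ge0//.
rewrite -lee_fin fineK//; apply: le_trans (norm_le n) _.
have : (`|0 - fine (tail n)| < (eps / 2) `^ p)%R by near: n; exact: tail_cvg.
rewrite sub0r normrN ger0_norm ?fine_ge0// => /ltW.
rewrite -lee_fin fineK// => tn.
have : tail n `^ p^-1 <= (eps / 2)%:E.
  apply: le_trans (le_poweR _ _ tn) _; rewrite ?invr_ge0 ?(ltW p0)//.
  rewrite poweR_EFin -powRrM mulfV// powRr1//.
  by rewrite divr_ge0// ltW.
move=> /(lee_wpmul2l (_ : 0 <= 2%:E)) -/(_ _)/le_trans; apply => //.
by rewrite -EFinM lee_fin mulrC divfK.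
Unshelve. all: by end_near. Qed.

End convergence.

Section remainder.
Context (R : realType) (X : metricType R).
Variables (e : nat -> int * nat) (e' : int * nat -> nat).
Hypotheses (eK : cancel e e') (e'K : cancel e' e).
Variables (theta : R) (f w : X -> R) (N : set X) (phi : int -> X -> R).
Variables (b : int * nat -> X -> R) (S : int * nat -> set X).
Variable M : int * nat -> R.
Hypothesis M0 : forall t, 0 <= M t.
Hypothesis t0 : 0 <= theta.
Hypothesis phiL : forall k, lipschitz_with (2 * 2 ^ k) (phi k).
Hypothesis phiB : forall k x, theta * `|phi k x| <= 2 ^ k.
Hypothesis phiE : forall k x, ~ N x -> w x <= 2 ^ k -> phi k x = f x.
Hypothesis bL : forall t, lipschitz_with (M t) (b t).
Hypothesis bB : forall t x, theta * `|b t x| <= M t.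
Hypothesis bS : forall t x, ~ S t x -> b t x = 0.
Hypothesis bsum : forall k x, exists n0, forall n, (n0 <= n)%N ->
  \sum_(i < n) b (k, i : nat) x = phi (k + 1) x - phi k x.

Let h n x :=
  (\sum_(0 <= j <oo) (M (e (j + n)%N) * \1_(S (e (j + n)%N)) x)%:E)%E.

(** At low levels the differences [phi k x - phi k y] tend to [0] because the
    Lipschitz constants do, although for [theta = 0] the values [phi k x] need
    not. *)
Lemma remainder_increment_le n x y : ~ N x -> ~ N y ->
  ((`|(f x - \sum_(j < n) b (e j) x) - (f y - \sum_(j < n) b (e j) y)|)%:E <=
    (mdist x y)%:E * (h n x + h n y))%E.
Proof.
move=> Nx Ny.
pose ga t := mdist x y * (M t * \1_(S t) x + M t * \1_(S t) y).
have := @enumerated_telescope R e e' eK e'K (fun k => phi k x - phi k y)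
  (fun t => b t x - b t y) ga (f x - f y) _ _ _ _ n.
rewrite sumrB => bound.
have -> : f x - \sum_(j < n) b (e j) x - (f y - \sum_(j < n) b (e j) y) =
    f x - f y - (\sum_(j < n) b (e j) x - \sum_(j < n) b (e j) y) by ring.
apply: le_trans (bound _ _ _ _) _.
- move=> k; have [nx hx] := bsum k x; have [ny hy] := bsum k y.
  exists (nx + ny)%N => m m_ge; rewrite sumrB hx ?hy; last 2 first.
  + exact: leq_trans (leq_addl _ _) m_ge.
  + exact: leq_trans (leq_addr _ _) m_ge.
  by ring.
- have [kx hx] := exprz_nat_ge (w x); have [ky hy] := exprz_nat_ge (w y).
  exists (kx + ky)%N => k k_ge; rewrite !phiE//.
  + exact/hy/(leq_trans (leq_addl _ _) k_ge).
  + exact/hx/(leq_trans (leq_addr _ _) k_ge).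
- move=> eps eps0; have [k0 small] := exprz_opp_small (2 * mdist x y) eps0.
  exists k0 => k /small; apply: le_trans.
  by apply: le_trans (phiL _ _ _) _; rewrite mulrAC.
- by move=> t; apply: lipschitz_bump => //; exact: bS.
have bump0 z j : (0 <= (M (e (j + n)%N) * \1_(S (e (j + n)%N)) z)%:E)%E.
  by rewrite lee_fin mulr_ge0.
rewrite /h -nneseriesD// -nneseriesZl; last by move=> j _; exact: adde_ge0.
apply: lee_nneseries => [j _ _|j _]; last by rewrite lee_fin.
by rewrite lee_fin mulr_ge0 ?mdist_ge0// addr_ge0// mulr_ge0.
Qed.

Lemma remainder_size_le n x : ~ N x ->
  ((theta * `|f x - \sum_(j < n) b (e j) x|)%:E <= h n x)%E.
Proof.
move=> Nx.
have := @enumerated_telescope R e e' eK e'K (fun k => theta * phi k x)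
  (fun t => theta * b t x) (fun t => M t * \1_(S t) x) (theta * f x) _ _ _ _ n.
rewrite -mulr_sumr -mulrBr normrM (ger0_norm t0); apply.
- move=> k; have [n0 hn] := bsum k x.
  by exists n0 => m /hn; rewrite -mulr_sumr => ->; rewrite mulrBr.
- have [kx hx] := exprz_nat_ge (w x).
  by exists kx => k /hx wk; rewrite phiE.
- move=> eps eps0; have [k0 small] := exprz_opp_small 1 eps0.
  exists k0 => k /small; apply: le_trans.
  by rewrite mul1r normrM (ger0_norm t0).
- move=> t; rewrite normrM (ger0_norm t0).
  have [Sx|Sx] := pselect (S t x); first by rewrite indicE mem_set// mulr1.
  by rewrite bS// normr0 mulr0 mulr_ge0.
Qed.

End remainder.

(** * Atomic decomposition *)

Theorem theorem3p4 (R : realType) (d : measure_display)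
    (X : measurableMetricType d R) (sigma : {measure set X -> \bar R})
    (p : R) (tau : \bar R) :
  uniformly_perfect X -> doubling_measure sigma ->
  0 < p -> p <= 1 -> (0 < tau)%E ->
  exists2 C : R, 0 < C &
    forall f g : X -> R,
      hajlasz_space sigma p tau f -> lipschitz_function f ->
      hajlasz_gradients sigma f g -> g \in Lfun sigma p%:E ->
      exists (a : nat -> X -> R) (lam : nat -> R),
        [/\ forall j, lipschitz_function (a j) /\
              hajlasz_atom sigma tau +oo%E p (a j),
            (fun n => hajlasz_norm sigma p tau
               (fun x => f x - \sum_(j < n) lam j * a j x)) @ \oo --> 0%E
          & (\sum_(0 <= j <oo) (`|lam j| `^ p)%:E <=
               C%:E * ((tau^-1) `^ p * (Lp_norm sigma p%:E f) `^ p +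
                       (Lp_norm sigma p%:E g) `^ p))%E].
Proof.
move=> _ doubling p0 p1 tau0; have pn0 : p != 0 by rewrite gt_eqF.
have [A A0 hA] := bump_decomposition doubling.
have D0 := dyadic_cst_gt0 p0.
exists (60 `^ p * A * dyadic_cst p); first by rewrite !mulr_gt0// powR_gt0.
move=> f g [mf fnorm] _ [mg g0 [N NN fgN]] gLp.
have [tauE t0] := inve_fin_num tau0; set theta := fine _ in t0.
pose w x := Num.max (g x) (theta * `|f x|).
have w0 x : 0 <= w x by rewrite le_max g0.
have mtf : measurable_fun setT (fun x => theta * `|f x|).
  by apply: measurable_funM => //; exact: measurableT_comp.
have mw : measurable_fun setT w by exact: measurable_maxr.
have int0 (v : X -> R) : (0 <= \int[sigma]_x ((v x) `^ p)%:E)%E.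
  by apply: integral_ge0 => x _; rewrite lee_fin powR_ge0.
have fE : ((tau^-1) `^ p * (Lp_norm sigma p%:E f) `^ p =
    \int[sigma]_x ((theta * `|f x|) `^ p)%:E)%E.
  rewrite -poweRM ?Lnorm_ge0//; last by rewrite inve_ge0 ltW.
  by rewrite tauE Lp_normZ// -poweRrM mulVf// poweRe1.
have gE : ((Lp_norm sigma p%:E g) `^ p = \int[sigma]_x ((g x) `^ p)%:E)%E.
  have := Lp_normZ sigma p0 ler01 mg; rewrite mul1e /Lp_norm => ->.
  rewrite -poweRrM (mulVf pn0) poweRe1; last first.
    by apply: integral_ge0 => x _; rewrite lee_fin powR_ge0.
  by apply: eq_integral => x _; rewrite mul1r ger0_norm.
have foo : (\int[sigma]_x ((theta * `|f x|) `^ p)%:E < +oo)%E.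
  rewrite -fE -poweRM ?Lnorm_ge0//; last by rewrite inve_ge0 ltW.
  apply: poweR_lty; apply: le_lt_trans fnorm; rewrite leeDl//.
  by apply: le_ereal_inf_tmp => _ [? _ <-]; exact: Lnorm_ge0.
have goo : (\int[sigma]_x ((g x) `^ p)%:E < +oo)%E.
  rewrite -gE; apply: poweR_lty.
  by move/andP: gLp => [_ /set_mem].
have wle : (\int[sigma]_x ((w x) `^ p)%:E <=
    (tau^-1) `^ p * (Lp_norm sigma p%:E f) `^ p +
      (Lp_norm sigma p%:E g) `^ p)%E.
  have mpow (v : X -> R) : measurable_fun setT v ->
      measurable_fun setT (fun x => ((v x) `^ p)%:E).
    move=> mv; apply/measurable_EFinP.
    exact: (measurableT_comp (measurable_powR p)).
  rewrite fE gE -ge0_integralD//; last 4 first.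
  - by move=> x _; rewrite lee_fin powR_ge0.
  - exact: mpow.
  - by move=> x _; rewrite lee_fin powR_ge0.
  - exact: mpow.
  apply: ge0_le_integral => //.
  - by move=> x _; rewrite lee_fin powR_ge0.
  - exact: mpow.
  - by apply: emeasurable_funD; exact: mpow.
  - move=> x _; rewrite -EFinD lee_fin /w.
    case: (leP (g x) (theta * `|f x|)) => _; last first.
      by rewrite lerDr powR_ge0.
    by rewrite lerDl powR_ge0.
have woo : (\int[sigma]_x ((w x) `^ p)%:E < +oo)%E.
  apply: le_lt_trans wle _; rewrite fE gE.
  exact: (lte_add_pinfty foo goo).
have [phi [phiL phiB phiE]] : exists phi : int -> X -> R,
    [/\ forall k, lipschitz_with (2 * 2 ^ k) (phi k),
        forall k x, theta * `|phi k x| <= 2 ^ k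
      & forall k x, ~ N x -> w x <= 2 ^ k -> phi k x = f x].
  apply: (lipschitz_approximations (g := g)) => // x.
  - by rewrite le_max lexx.
  - by rewrite le_max lexx orbT.
have phiN k x : ~ N x -> w x <= 2 ^ k -> phi (k + 1) x = phi k x.
  move=> Nx wx; rewrite !phiE// (le_trans wx)//.
  by rewrite ler_eXz2l ?ltr1n// lerDl.
have [b [c [rho [bL bsupp bB bsum bmeas]]]] :=
  hA theta p w phi N p0 mw w0 NN phiL t0 phiB phiN woo.
have [e [e' [eK e'K]]] := int_nat_enumeration.
have M0 (t : int * nat) : 0 < 60 * 2 ^ t.1 :> R by rewrite mulr_gt0// exprz_gt0.
have /choice[z zP] : forall t, exists z : (X -> R) * R,
    [/\ lipschitz_function z.1 /\ hajlasz_atom sigma tau +oo%E p z.1,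
        forall x, z.2 * z.1 x = b t x
      & ((`|z.2| `^ p)%:E =
          ((60 * 2 ^ t.1) `^ p)%:E * sigma (ball (c t) (rho t)))%E].
  move=> t; have [rho0 b0] := bsupp t.
  have [a [lam h]] :=
    normalized_atom doubling tau0 p0 (M0 t) rho0 (bL t) b0 (bB t).
  by exists (a, lam).
have sumE : (\sum_(0 <= j <oo) (`|(z (e j)).2| `^ p)%:E =
    \esum_(t in [set: int * nat])
      (((60 * 2 ^ t.1) `^ p)%:E * sigma (ball (c t) (rho t))))%E.
  rewrite (reindex_esum [set: nat] _ e); last first.
    by rewrite setTT_bijective; exists e'.
  rewrite -nneseries_esumT => [|j]; last by rewrite mule_ge0// lee_fin powR_ge0.
  by apply: eq_eseriesr => j _; have [_ _] := zP (e j).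
have K0 : (0 <= (60 `^ p * A * dyadic_cst p)%:E)%E.
  by rewrite lee_fin !mulr_ge0 ?powR_ge0// ltW.
exists (fun j => (z (e j)).1), (fun j => (z (e j)).2); split.
- by move=> j; have [] := zP (e j).
- have FE n : (fun x => f x - \sum_(j < n) (z (e j)).2 * (z (e j)).1 x) =
      (fun x => f x - \sum_(j < n) b (e j) x).
    apply/funext => x; congr (_ - _); apply: eq_bigr => j _.
    by have [_ ->] := zP (e j).
  under eq_fun do rewrite FE.
  have mball t : measurable (ball (c t) (rho t)).
    exact: (measurable_mball doubling).
  have M0' (t : int * nat) : 0 <= 60 * 2 ^ t.1 :> R by exact: ltW.
  have bball t x : ~ ball (c t) (rho t) x -> b t x = 0.
    by apply: vanishing_outside_mball; have [] := bsupp t.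
  apply: (hajlasz_norm_cvg0 (M := fun j => 60 * 2 ^ (e j).1)
    (B := fun j => ball (c (e j)) (rho (e j))) tau0 p0 p1 _ _ _ NN) => //.
  + move=> n; apply: measurable_funB => //; apply: measurable_sum => j.
    exact: (measurable_lipschitz_with doubling (bL _)).
  + move=> n x y Nx Ny.
    exact: (remainder_increment_le eK e'K M0' phiL phiE bL bball bsum).
  + move=> n x Nx.
    exact: (remainder_size_le eK e'K M0' t0 phiB phiE bB bball bsum).
  + rewrite (eq_eseriesr (g := fun j => (`|(z (e j)).2| `^ p)%:E)); last first.
      by move=> j _; have [_ _ ->] := zP (e j).
    rewrite sumE; apply: le_lt_trans bmeas _.
    by rewrite lte_mul_pinfty.
- rewrite sumE; apply: le_trans bmeas _.
  by rewrite lee_wpmul2l.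
Qed.
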